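(* Let $\eta\in\mathbb N\cup\{\infty\}$ and $\kappa\in\mathbb Z_+$, let $X=X_{\eta,\kappa}$ and $\phi=\phi_{\eta,\kappa}$ be the set and self-map described in the context, and let $\mu$ be a discrete measure on $X$ such that the composition operator $C_\phi$ in $L^2(\mu)$ is densely defined. Let $\{P(x,\cdot)\}_{x\in X}$ be a family of Borel probability measures on $\mathbb R_+$. Then $\{P(x,\cdot)\}_{x\in X}$ satisfies the consistency condition (CC) if and only if the following three conditions are satisfied (where $\mathfrak B(\mathbb R_+)$ is the Borel $\sigma$-algebra of $\mathbb R_+$): (i) $P(x_r,\sigma)=\frac{\mu(x_0)}{\mu(x_r)}\int_\sigma t^rP(x_0,dt)$ for all $r\in\{0,\ldots,\kappa\}$ and $\sigma\in\mathfrak B(\mathbb R_+)$, (ii) $\sum_{i=1}^\eta\frac{\mu(x_{i,1})}{\mu(x_0)}P(x_{i,1},\sigma)=\int_\sigma(t^{\kappa+1}-1)P(x_0,dt)$ for all $\sigma\in\mathfrak B(\mathbb R_+)$, (iii) $P(x_{i,j},\sigma)=\frac{\mu(x_{i,1})}{\mu(x_{i,j})}\int_\sigma t^{j-1}P(x_{i,1},dt)$ for all $i\in J_\eta$, $j\in\{2,3,\ldots\}$ and $\sigma\in\mathfrak B(\mathbb R_+)$. Moreover, if $\{P(x,\cdot)\}_{x\in X}$ satisfies (CC), then (iv) $P(x_r,[0,1))=P(x_{i,j},[0,1])=0$ for all $r\in\{0,\ldots,\kappa\}$, $i\in J_\eta$ and $j\in\mathbb N$, (v) $P(x_0,\sigma\cap(1,\infty))=\sum_{i=1}^\eta\frac{\mu(x_{i,1})}{\mu(x_0)}\int_\sigma\frac1{t^{\kappa+1}-1}P(x_{i,1},dt)$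 for all $\sigma\in\mathfrak B(\mathbb R_+)$, (vi) $\sum_{i=1}^\eta\frac{\mu(x_{i,1})}{\mu(x_0)}\int_0^\infty\frac1{t^{\kappa+1}-1}P(x_{i,1},dt)\le1$, (vii) $P(x_0,\{1\})=\vartheta:=1-\sum_{i=1}^\eta\frac{\mu(x_{i,1})}{\mu(x_0)}\int_0^\infty\frac1{t^{\kappa+1}-1}P(x_{i,1},dt)$, (viii) $P(x_0,\sigma)=\sum_{i=1}^\eta\frac{\mu(x_{i,1})}{\mu(x_0)}\int_\sigma\frac1{t^{\kappa+1}-1}P(x_{i,1},dt)+\vartheta\,\delta_1(\sigma)$ for all $\sigma\in\mathfrak B(\mathbb R_+)$, (ix) $\sum_{i=1}^\eta\frac{\mu(x_{i,1})}{\mu(x_0)}\int_0^\infty\frac{t^{\kappa+1}}{t^{\kappa+1}-1}P(x_{i,1},dt)<\infty$.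
   Context: Notation: $\mathbb N=\{1,2,\ldots\}$, $\mathbb Z_+=\{0,1,2,\ldots\}$, $\mathbb R_+=[0,\infty)$, $J_k=\{i\in\mathbb N:i\le k\}$ for $k\in\mathbb Z_+\cup\{\infty\}$ ($J_0=\emptyset$, $J_\infty=\mathbb N$); $0^0=1$; $\int_0^\infty$ means $\int_{[0,\infty)}$; $\delta_1$ is the Dirac measure at $1$. All measures are positive. Integrals with denominator $t^{\kappa+1}-1$ are taken with respect to the measures $P(x_{i,1},\cdot)$, which vanish on $[0,1]$ by (iv), i.e. effectively over subsets of $(1,\infty)$. The set and the symbol. $X=X_{\eta,\kappa}=\{x_0,\ldots,x_\kappa\}\cup\{x_{i,j}:i\in J_\eta,\ j\in\mathbb N\}$, all listed points being distinct, and $\phi=\phi_{\eta,\kappa}\colon X\to X$ is given by $\phi(x_{i,j})=x_{i,j-1}$ for $i\in J_\eta$, $j\ge2$; $\phi(x_{i,1})=x_\kappa$ for $i\in J_\eta$; $\phi(x_0)=x_\kappa$; $\phi(x_r)=x_{r-1}$ for $r\in J_\kappa$. Operators. A discrete measure on $X$ is a $\sigma$-finite measure $\mu$ on $2^X$ with $\mu(x):=\mu(\{x\})>0$ for all $x\in X$ (so $\mu(x)<\infty$ as well). The composition operator $C_\phi$ in $L^2(\mu)$ has domain $\{f\in L^2(\mu):f\circ\phi\in L^2(\mu)\}$ and $C_\phi f=f\circ\phi$. Consistency condition. A family $\{P(x,\cdot)\}_{x\in X}$ of Borel probability measures on $\mathbb R_+$ satisfies (CC) if $\frac1{\mu(x)}\sum_{y\in\phi^{-1}(\{x\})}\mu(y)P(y,\sigma)=\int_\sigma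 t\,P(x,dt)$ for every Borel $\sigma\subseteq\mathbb R_+$ and every $x\in\phi(X)$. *)

(* Defs.v *)
From HB Require Import structures.
From mathcomp Require Import all_boot all_order all_algebra.
From mathcomp Require Import all_classical all_reals all_analysis.
From mathcomp Require Import complex.

Set Implicit Arguments.
Unset Strict Implicit.
Unset Printing Implicit Defensive.

Import Order.TTheory GRing.Theory Num.Theory.
Import numFieldNormedType.Exports.

Local Open Scope classical_set_scope.
Local Open Scope ring_scope.
Local Open Scope ereal_scope.

(* Elements of N \cup {oo} or Z_+ \cup {oo} are encoded in [option nat], with
   [None] standing for oo; thus [J None] is N = {1, 2, ...}. *)
Definition J (k : option nat) : Type :=
  {i : nat | (0 < i)%N && (if k is Some n then (i <= n)%N else true)}.

HB.instance Definition _ (k : option nat) := SubCountable.on (J k).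

Definition J1 : J None := exist _ 1%N isT.

(* [inl r] is x_r for r in {0, ..., kappa}, [inr (i, j)] is x_{i,j}. *)
Definition X (eta : option nat) (kappa : nat) : Type :=
  ('I_kappa.+1 + J eta * J None)%type.

Definition xt (eta : option nat) (kappa : nat) (r : 'I_kappa.+1) : X eta kappa :=
  inl r.

Definition xb (eta : option nat) (kappa : nat) (i : J eta) (j : J None) :
  X eta kappa := inr (i, j).

HB.instance Definition _ (eta : option nat) (kappa : nat) :=
  Countable.on (X eta kappa).
HB.instance Definition _ (eta : option nat) (kappa : nat) :=
  isPointed.Build (X eta kappa) (xt eta ord0).
HB.instance Definition _ (eta : option nat) (kappa : nat) :=
  @isMeasurable.Build default_measure_display (X eta kappa)
    discrete_measurable discrete_measurable0
    discrete_measurableC discrete_measurableU.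

(* [insub (val j).-1] is [Some (j - 1)] when j >= 2, and [None] when j = 1
   because 0 is not in N. *)
Definition phi (eta : option nat) (kappa : nat) (x : X eta kappa) :
  X eta kappa :=
  match x with
  | inl r => if r == ord0 then xt eta ord_max else xt eta (inord r.-1)
  | inr (i, j) =>
      if insub (val j).-1 is Some j' then xb kappa i j'
      else xt eta ord_max
  end.

Definition discrete_measure (R : realType) (eta : option nat) (kappa : nat)
    (mu : {measure set (X eta kappa) -> \bar R}) : Prop :=
  sigma_finite [set: X eta kappa] mu /\ forall x, 0 < mu [set x].

Section composition_operator.
Context d (T : measurableType d) (R : realType).
Variable mu : {measure set T -> \bar R}.

Definition L2norm (f : T -> R[i]) : \bar R :=
  'N[mu]_2%:E [(fun x => (Normc.normc (f x))%:E)].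

(* For a discrete measure no nonempty set is null, so that no quotient is
   needed: the elements of L^2(mu) are functions. *)
Definition L2 : set (T -> R[i]) :=
  [set f | [/\ measurable_fun setT (fun x => complex.Re (f x)),
               measurable_fun setT (fun x => complex.Im (f x)) &
               L2norm f < +oo]].

Definition comp_op_domain (psi : T -> T) : set (T -> R[i]) :=
  [set f | L2 f /\ L2 (f \o psi)].

Definition comp_op_densely_defined (psi : T -> T) : Prop :=
  forall f, L2 f -> forall e : R, (0 < e)%R ->
    exists2 g, comp_op_domain psi g & L2norm (f \- g)%R < e%:E.

End composition_operator.

Definition Rplus (R : realType) : set (measurableTypeR R) :=
  `[(0 : R)%R, +oo[%classic.

Definition BRplus (R : realType) : set (set (measurableTypeR R)) :=
  [set s : set (measurableTypeR R) | measurable s /\ s `<=` @Rplus R].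

(* A Borel probability measure on R_+ is encoded as a Borel probability measure
   on R that is concentrated on R_+. *)
Definition on_Rplus (R : realType)
    (Q : probability (measurableTypeR R) R) : Prop := Q (@Rplus R) = 1.

Definition CC (R : realType) (eta : option nat) (kappa : nat)
    (mu : {measure set (X eta kappa) -> \bar R})
    (P : X eta kappa -> probability (measurableTypeR R) R) : Prop :=
  forall (s : set (measurableTypeR R)) (x : X eta kappa),
    BRplus s -> range (@phi eta kappa) x ->
    ((mu [set x])^-1 *
      \esum_(y in @phi eta kappa @^-1` [set x]) (mu [set y] * P y s))%E
    = \int[P x]_(t in s) t%:E.

(* At t = 1 the integrand takes the conventional value 0; this is harmless for
   the measures P(x_{i,1}, .), which vanish on [0, 1] whenever (CC) holds. For
   the same reason all terms of the sum are then nonnegative, so that [\esum]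
   is the usual sum. *)
Definition sum_inv (R : realType) (eta : option nat) (kappa : nat)
    (mu : {measure set (X eta kappa) -> \bar R})
    (P : X eta kappa -> probability (measurableTypeR R) R)
    (s : set (measurableTypeR R)) : \bar R :=
  \esum_(i in [set: J eta])
    (mu [set xb kappa i J1] / mu [set xt eta ord0] *
     \int[P (xb kappa i J1)]_(t in s) ((t ^+ kappa.+1 - 1)^-1)%:E).

Definition vartheta (R : realType) (eta : option nat) (kappa : nat)
    (mu : {measure set (X eta kappa) -> \bar R})
    (P : X eta kappa -> probability (measurableTypeR R) R) : \bar R :=
  1 - sum_inv mu P (@Rplus R).

(* Main.v *)
Require Import Defs.
From mathcomp Require Import all_boot all_order all_algebra.
From mathcomp Require Import all_classical all_reals all_analysis.
From mathcomp Require Import complex ring lra measurable_realfun.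

Set Implicit Arguments.
Unset Strict Implicit.
Unset Printing Implicit Defensive.

Import Order.TTheory GRing.Theory Num.Theory.
Import numFieldNormedType.Exports.

Local Open Scope classical_set_scope.
Local Open Scope ring_scope.
Local Open Scope ereal_scope.

(** The consistency condition is local: at a point [x] it involves only [P x]
    and the measures at the points of [phi @^-1` [set x]].  With an arrow
    from each point to its image, the graph of [phi] is a cycle
    x_0 <- x_1 <- ... <- x_kappa <- x_0 at whose top x_kappa the branches
    x_kappa <- x_{i,1} <- x_{i,2} <- ... are attached, so there are two kinds of
    equations.

    At every point other than x_kappa the preimage is a single point y, and the
    equation says that [P y] is, up to a factor, the measure with density [t]
    with respect to [P x].  Iterating along x_0, ..., x_kappa gives (i), and along
    a branch gives (iii); this is [moment_chain], which rests on the rule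
    [ge0_integral_density] for integrating against a measure with a density.

    At x_kappa the preimage consists of x_0 and all the x_{i,1}.  By (i) the right
    hand side is a multiple of the integral of [t ^+ kappa.+1] against
    [P x_0], and since [P x_0] is finite its own contribution can be moved
    to that side, which gives (ii).  Together these are [CC_moments].

    The other assertions come from (ii), read as: the combination [nu] of the
    [P x_{i,1}] has density [w t = t ^+ kappa.+1 - 1] with respect to [P x_0].
    On [0, 1] the density is nonpositive while [nu] is a positive measure, so
    both sides vanish there; as [w < 0] on [0, 1), this yields (iv).  On
    (1, +oo) the density is positive, so dividing by it recovers [P x_0] from
    [nu] ([esum_integral_div]), which is (v).  The mass that is left sits at the
    point 1 ([split_at1]), whence (vi), (vii) and (viii).  Finally (ix) is the
    integral of [t ^+ kappa.+1] over (1, +oo) against [P x_0], which is finite as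
    soon as the numbers mu(x_{i,1}) are summable.  This is where density of the
    domain enters: it provides a function [g] with [g x_kappa != 0] such that
    [g] composed with [phi] is square integrable, so the preimage of x_kappa has
    finite measure ([densely_defined_preimage_top_fin]). *)

(** * Integration against measures with a density *)

Section density.
Context d (T : measurableType d) (R : realType).
Variables (nu m : {measure set T -> \bar R}) (D : set T) (w : T -> R).
Hypothesis mD : measurable D.
Hypothesis mw : measurable_fun D w.
Hypothesis w0 : forall x, D x -> (0 <= w x)%R.
Hypothesis nuE : forall A, measurable A -> A `<=` D ->
  nu A = \int[m]_(x in A) (w x)%:E.

Import HBNNSimple.

Let ge0_integral_density_nnsfun (h : {nnsfun T >-> R}) :
  \int[nu]_(x in D) (h x)%:E = \int[m]_(x in D) ((h x)%:E * (w x)%:E).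
Proof.
have mpre r : measurable (h @^-1` [set r]).
  exact: measurable_funPTI.
have mind r : measurable_fun D (fun x => (r * \1_(h @^-1` [set r]) x)%:E).
  by apply/measurable_EFinP/measurable_funM => //; exact: measurable_funTS.
have mwE : measurable_fun D (EFin \o w) by exact/measurable_EFinP.
transitivity (\int[nu]_(x in D)
    (\sum_(y \in range h) (y * \1_(h @^-1` [set y]) x)%:E)).
  by apply: eq_integral => t tD; rewrite /= fimfunE -fsumEFin.
rewrite ge0_integral_fsum//; last by move=> n y _; exact: nnfun_muleindic_ge0.
transitivity (\int[m]_(x in D) (\sum_(y \in range h)
    ((y * \1_(h @^-1` [set y]) x)%:E * (w x)%:E))); last first.
  apply: eq_integral => x xD; rewrite -ge0_mule_fsuml => [|y].
    by rewrite fsumEFin // -(fimfunE _ x).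
  exact: nnfun_muleindic_ge0.
rewrite ge0_integral_fsum//; last 2 first.
  - by move=> y; exact: emeasurable_funM.
  - by move=> n y Dy; rewrite mule_ge0 ?lee_fin ?w0// -lee_fin nnfun_muleindic_ge0.
apply: eq_fsbigr => r rh.
rewrite integralZl_indic_nnsfun//.
under [RHS]eq_integral do rewrite EFinM -muleA.
rewrite ge0_integralZl//.
- congr (_ * _).
  transitivity (\int[m]_(x in D) ((EFin \o w) \_ (h @^-1` [set r])) x).
    by rewrite -integral_mkcondr integral_indic// setIC nuE//; exact: measurableI.
  by apply: eq_integral => x _; rewrite epatch_indic/= muleC.
- apply: emeasurable_funM => //; apply/measurable_EFinP; exact: measurable_funTS.
- by move=> t Dt; rewrite mule_ge0 ?lee_fin ?w0.
- by move: rh; rewrite inE => -[t _ <-]; rewrite lee_fin.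
Qed.

(** Monotone limits reduce the rule to simple functions, and linearity reduces
    these to indicators, for which it is the hypothesis on [nu]. *)
Lemma ge0_integral_density (f : T -> \bar R) : measurable_fun D f ->
    (forall x, D x -> 0 <= f x) ->
  \int[nu]_(x in D) f x = \int[m]_(x in D) (f x * (w x)%:E).
Proof.
move=> mf f0; pose h := nnsfun_approx mD mf.
have mwE : measurable_fun D (EFin \o w) by exact/measurable_EFinP.
have mh n : measurable_fun D (EFin \o h n).
  by apply/measurable_EFinP; exact: measurable_funTS.
have cvgh x : D x -> EFin \o h^~ x @ \oo --> f x.
  by move=> Dx; exact: cvg_nnsfun_approx.
have ndh x a b : (a <= b)%N -> (h a x <= h b x)%R.
  by move=> ab; exact/lefP/nd_nnsfun_approx.
transitivity (limn (fun n => \int[nu]_(x in D) (h n x)%:E)).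
  rewrite -monotone_convergence//.
  - by apply: eq_integral => x /[!inE] Dx; apply/esym/cvg_lim => //; exact: cvgh.
  - by move=> n x Dx; rewrite lee_fin.
  - by move=> x Dx a b ab; rewrite lee_fin ndh.
under eq_fun do rewrite ge0_integral_density_nnsfun.
rewrite -monotone_convergence//.
- apply: eq_integral => x /[!inE] Dx; apply/cvg_lim => //.
  by apply: cvgeZr => //; exact: cvgh.
- by move=> n; apply: (emeasurable_funM (mh n) mwE).
- by move=> n x Dx; rewrite mule_ge0 ?lee_fin ?w0.
- by move=> x Dx a b ab; rewrite lee_wpmul2r ?lee_fin ?w0// ndh.
Qed.

End density.

Section esum_countType.
Context (R : realType) (I : countType).
Implicit Types a : I -> \bar R.

(** Series of measures are indexed by [nat]; numbering [I] by the codes of its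
    elements turns a sum over [I] into such a series. *)
Lemma esum_pickle a : (forall i, 0 <= a i) ->
  \esum_(i in [set: I]) a i = \sum_(n <oo) oapp a 0 (pickle_inv n).
Proof.
move=> a0.
rewrite nneseries_esumT; last by move=> n; case: pickle_inv => /=.
rewrite [RHS](esumID (range (@pickle I))); last by move=> n _; case: pickle_inv => /=.
rewrite !setTI [X in _ + X]esum1 ?adde0; last first.
  move=> n /=; case E : (pickle_inv n) => [i|//] [].
  by exists i => //; have := @pickle_invK I n; rewrite E.
rewrite esum_image; first by apply: eq_esum => i _; rewrite pickleK_inv.
by move=> i j _ _; exact: (pcan_inj (@pickleK I)).
Qed.

Lemma ge0_esumZl a (r : R) : (forall i, 0 <= a i) -> (0 <= r)%R ->
  \esum_(i in [set: I]) (r%:E * a i) = r%:E * \esum_(i in [set: I]) a i.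
Proof.
move=> a0 r0; rewrite !esum_pickle//; last by move=> i; rewrite mule_ge0 ?lee_fin.
rewrite -nneseriesZl; last by move=> n _; case: pickle_inv => /=.
by apply: eq_eseriesr => n _; case: pickle_inv => [i|] //=; rewrite mule0.
Qed.

End esum_countType.

Section density_series.
Context d (T : measurableType d) (R : realType) (I : countType).
Variables (c : I -> R) (nu : I -> {measure set T -> \bar R}).
Variables (m : {measure set T -> \bar R}) (D : set T) (w : T -> R).
Hypothesis c0 : forall i, (0 <= c i)%R.
Hypothesis mD : measurable D.
Hypothesis mw : measurable_fun D w.
Hypothesis w0 : forall x, D x -> (0 <= w x)%R.
Hypothesis nuE : forall A, measurable A -> A `<=` D ->
  \esum_(i in [set: I]) ((c i)%:E * nu i A) = \int[m]_(x in A) (w x)%:E.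

Let nu_ (n : nat) : {measure set T -> \bar R} :=
  if pickle_inv n is Some i then mscale (NngNum (c0 i)) (nu i) else mzero.

Let nu_E A : \esum_(i in [set: I]) ((c i)%:E * nu i A) = mseries nu_ 0 A.
Proof.
rewrite esum_pickle; last by move=> i; rewrite mule_ge0 ?lee_fin.
by apply: eq_eseriesr => n _; rewrite /nu_; case: pickle_inv.
Qed.

(** Both sides are the integral of [f] against the measure that is the sum of
    the [c i] multiples of the [nu i], whose density is [w]. *)
Lemma ge0_esum_integral_density (f : T -> \bar R) : measurable_fun D f ->
    (forall x, D x -> 0 <= f x) ->
  \esum_(i in [set: I]) ((c i)%:E * \int[nu i]_(x in D) f x) =
  \int[m]_(x in D) (f x * (w x)%:E).
Proof.
move=> mf f0.
rewrite -(@ge0_integral_density _ _ _ (mseries nu_ 0) m)//; last first.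
  by move=> A mA AD; rewrite -nuE// nu_E.
rewrite ge0_integral_measure_series// esum_pickle; last first.
  by move=> i; rewrite mule_ge0 ?lee_fin// integral_ge0.
apply: eq_eseriesr => n _; rewrite /nu_; case: pickle_inv => [i|] /=.
  by rewrite ge0_integral_mscale.
by rewrite integral_measure_zero.
Qed.

End density_series.

(** * Measures on the half-line and their moments *)

Section half_line.
Context (R : realType).
Notation mR := (measurableTypeR R).
Implicit Types (s : set mR) (Q : {measure set mR -> \bar R}).

Lemma measurable_BRplus s : BRplus s -> measurable s. Proof. by case. Qed.

Lemma BRplus_ge0 s t : BRplus s -> s t -> (0 <= t)%R.
Proof. by case=> _ sR /sR; rewrite /Rplus/= in_itv/= andbT. Qed.

Lemma BRplus_subset s1 s2 : BRplus s1 -> measurable s2 -> s2 `<=` s1 -> BRplus s2.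
Proof. by move=> [_ s1R] ms2 s21; split => //; exact: subset_trans s1R. Qed.

Lemma BRplus_Rplus : BRplus (@Rplus R).
Proof. by split => //; exact: measurable_itv. Qed.

Lemma BRplus01 : BRplus (`[0%R, 1%R]%classic : set mR).
Proof.
split; first exact: measurable_itv.
by move=> t; rewrite /Rplus/= !in_itv/= andbT => /andP[].
Qed.

Lemma BRplus01o : BRplus (`[0%R, 1%R[%classic : set mR).
Proof.
apply: BRplus_subset BRplus01 _ _; first exact: measurable_itv.
by move=> t /=; rewrite !in_itv/= => /andP[-> /ltW].
Qed.

Lemma measurable_exprn n s : measurable_fun s (fun t : mR => t ^+ n)%R.
Proof. by apply: measurable_funTS; exact: exprn_measurable. Qed.

Lemma exprn_ge0_BRplus n s t : BRplus s -> s t -> (0 <= t ^+ n)%R.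
Proof. by move=> Bs st; rewrite exprn_ge0// (BRplus_ge0 Bs). Qed.

Lemma integral_expr0 Q s : measurable s ->
  \int[Q]_(t in s) (t ^+ 0)%:E = Q s.
Proof.
by move=> ms; under eq_integral do rewrite expr0; rewrite integral_cst ?mul1e.
Qed.

Lemma integral_expr_density Q0 Q1 (c : R) n s : (0 <= c)%R -> BRplus s ->
    (forall A, BRplus A -> Q1 A = c%:E * \int[Q0]_(t in A) (t ^+ n)%:E) ->
  \int[Q1]_(t in s) t%:E = c%:E * \int[Q0]_(t in s) (t ^+ n.+1)%:E.
Proof.
move=> c0 Bs Q1E; have ms := measurable_BRplus Bs.
have mX k A : measurable_fun A (fun t : mR => (t ^+ k)%:E).
  by apply/measurable_EFinP; exact: measurable_exprn.
rewrite (@ge0_integral_density _ _ _ Q1 Q0 s (fun t => c * t ^+ n)%R ms).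
- rewrite -ge0_integralZl//.
  + by apply: eq_integral => t _; rewrite -!EFinM exprS mulrCA.
  + by move=> t st; rewrite lee_fin (exprn_ge0_BRplus _ Bs).
- by apply: measurable_funM => //; exact: measurable_exprn.
- by move=> t st; rewrite mulr_ge0// (exprn_ge0_BRplus _ Bs).
- move=> A mA As; have BA := BRplus_subset Bs mA As.
  rewrite Q1E// -ge0_integralZl//.
  by move=> t At; rewrite lee_fin (exprn_ge0_BRplus _ BA).
- exact/measurable_EFinP.
- by move=> t st; rewrite lee_fin (BRplus_ge0 Bs).
Qed.

(** Each equation on the left says that [Q n.+1] has density proportional to
    [t] with respect to [Q n].  Densities multiply along the chain, and so do the
    ratios of consecutive weights, whose product telescopes to [a 0 / a n]. *)
Lemma moment_chain (Q : nat -> {measure set mR -> \bar R}) (a : nat -> R) N :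
    (forall n, (0 < a n)%R) ->
  (forall n s, (n < N)%N -> BRplus s ->
     (a n)^-1%:E * ((a n.+1)%:E * Q n.+1 s) = \int[Q n]_(t in s) t%:E) <->
  (forall n s, (n <= N)%N -> BRplus s ->
     Q n s = (a 0%N / a n)%:E * \int[Q 0%N]_(t in s) (t ^+ n)%:E).
Proof.
move=> a0; have an0 n : a n != 0%R by rewrite gt_eqF.
have next n : (forall A, BRplus A ->
      Q n A = (a 0%N / a n)%:E * \int[Q 0%N]_(t in A) (t ^+ n)%:E) ->
    forall s, BRplus s ->
      \int[Q n]_(t in s) t%:E =
      (a 0%N / a n)%:E * \int[Q 0%N]_(t in s) (t ^+ n.+1)%:E.
  move=> QE s Bs; apply: integral_expr_density => //.
  by rewrite divr_ge0 ?ltW.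
split => QE.
- elim=> [|n IH] s nN Bs.
    by rewrite integral_expr0 ?divff ?mul1e//; exact: measurable_BRplus.
  have := QE n s nN Bs; rewrite next//; last by move=> A; apply: IH; exact: ltnW.
  move=> /(congr1 (fun x => (a n / a n.+1)%:E * x)).
  rewrite !muleA -!EFinM.
  rewrite (_ : _ * _ * a n.+1 = 1)%R; last by field; rewrite !an0.
  by rewrite mul1e => ->; congr (_%:E * _); field; rewrite !an0.
- move=> n s nN Bs; rewrite next//; last by move=> A; apply: QE; exact: ltnW.
  rewrite QE// !muleA -!EFinM; congr (_%:E * _).
  by field; rewrite !an0.
Qed.

(** The integral of [f] may be infinite, so linearity for integrable functions
    does not apply.  Writing [g] for [f - 1], the identity
    [g^\+ + 1 = f + g^\-] involves nonnegative functions only, and [g^\-] is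
    bounded by 1, so that its integral can be subtracted. *)
Lemma ge0_integralB1 Q s (f : mR -> R) : measurable s -> Q s < +oo ->
    measurable_fun s f -> (forall t, s t -> (0 <= f t)%R) ->
  \int[Q]_(t in s) (f t - 1)%:E = \int[Q]_(t in s) (f t)%:E - Q s.
Proof.
move=> ms Qs mf f0; set g := fun t => (f t - 1)%:E.
have mg : measurable_fun s g.
  by apply/measurable_EFinP; exact: measurable_funB.
have Qfin : Q s \is a fin_num by rewrite ge0_fin_numE.
have Q1 : \int[Q]_(t in s) (cst 1 t) = Q s by rewrite integral_cst ?mul1e.
have gN : \int[Q]_(t in s) g^\- t \is a fin_num.
  rewrite ge0_fin_numE ?integral_ge0//; apply: le_lt_trans Qs; rewrite -Q1.
  apply: ge0_le_integral => //; first exact: measurable_funeneg.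
  move=> t st; rewrite funenegE /g -EFinN -EFin_max lee_fin ge_max opprB.
  by rewrite ler01 andbT; have := f0 _ st; lra.
have gP : \int[Q]_(t in s) g^\+ t + Q s =
    \int[Q]_(t in s) (f t)%:E + \int[Q]_(t in s) g^\- t.
  rewrite -{1}Q1 -!ge0_integralD//.
  - apply: eq_integral => t _; rewrite funeposE funenegE /g -EFinN -!EFin_max.
    by rewrite -!EFinD; congr EFin; case: (leP (f t - 1)%R 0%R) => ?;
      case: (leP (- (f t - 1))%R 0%R) => ?; lra.
  - exact/measurable_EFinP.
  - exact: measurable_funeneg.
  - exact: measurable_funepos.
have subr (x y : \bar R) (b c : R) :
    x + b%:E = y + c%:E -> x - c%:E = y - b%:E.
  by case: x y => [x||] [y||]//= [] xy; congr EFin; lra.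
by rewrite integralE; move: gP; rewrite -(fineK gN) -(fineK Qfin); exact: subr.
Qed.

(** The function may fail to be integrable, so that its positive and negative
    parts are treated apart. *)
Lemma integral_setD_null Q D N (f : mR -> \bar R) : measurable D ->
    measurable N -> measurable_fun D f -> Q N = 0 ->
  \int[Q]_(t in D) f t = \int[Q]_(t in D `\` N) f t.
Proof.
move=> mD mN mf QN; rewrite integralE [RHS]integralE.
by congr (_ - _); apply: ge0_negligible_integral => //;
  [exact: measurable_funepos|exact: measurable_funeneg].
Qed.

(** The identity [x^-1 = x * (x ^+ 2)^-1] also holds at 0, and inversion of a
    nonnegative number is a real power, which is known to be measurable. *)
Lemma measurable_invB1 n s :
  measurable_fun s (fun t : mR => (t ^+ n - 1)^-1)%R.
Proof.
have mB : measurable_fun s (fun t : mR => t ^+ n - 1)%R.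
  by apply: measurable_funB => //; exact: measurable_exprn.
rewrite [X in measurable_fun _ X](_ : _ =
    fun t => ((t ^+ n - 1) * ((t ^+ n - 1) ^+ 2) `^ (-1))%R).
  apply: measurable_funM => //; apply: (measurableT_comp (measurable_powR _)).
  exact: measurable_funX.
apply/funext => t; rewrite powR_inv1 ?sqr_ge0//.
have [->|t0] := eqVneq (t ^+ n - 1)%R 0%R; first by rewrite invr0 mul0r.
by rewrite expr2 invfM mulrA mulfV// mul1r.
Qed.

End half_line.

(** * The measure at the root, seen from the branches *)

Section representing_measure.
Context (R : realType) (I : countType) (kappa : nat).
Notation mR := (measurableTypeR R).
Variables (c : I -> R) (nu : I -> {measure set mR -> \bar R}).
Variable P0 : {measure set mR -> \bar R}.
Hypothesis c_gt0 : forall i, (0 < c i)%R.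
Hypothesis nuE : forall s, BRplus s ->
  \esum_(i in [set: I]) ((c i)%:E * nu i s) =
  \int[P0]_(t in s) (t ^+ kappa.+1 - 1)%:E.

Let c_ge0 i : (0 <= c i)%R. Proof. exact: ltW. Qed.

Let w (t : R) : R := (t ^+ kappa.+1 - 1)%R.

Let w_le0 (t : R) : (0 <= t)%R -> (t <= 1)%R -> (w t <= 0)%R.
Proof. by move=> t0 t1; rewrite /w subr_le0 exprn_ile1. Qed.

Let w_gt0 (t : R) : (1 < t)%R -> (0 < w t)%R.
Proof. by move=> t1; rewrite /w subr_gt0 exprn_egt1. Qed.

Let mw s : measurable_fun s (w : mR -> R).
Proof. by apply: measurable_funB => //; exact: measurable_exprn. Qed.

(* On [0, 1] the density is nonpositive, and it integrates to a sum of
   nonnegative terms. *)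
Let int_w01 s : BRplus s -> s `<=` `[0%R, 1%R]%classic ->
  \esum_(i in [set: I]) ((c i)%:E * nu i s) = 0 /\
  \int[P0]_(t in s) `|(w t)%:E| = 0.
Proof.
move=> Bs s01; have ms := measurable_BRplus Bs.
have absw t : s t -> (w t)%:E = - `|(w t)%:E|.
  move=> /s01/=; rewrite in_itv/= => /andP[t0 t1].
  by rewrite /= ler0_norm ?w_le0// opprK.
have sum_ge0 : 0 <= \esum_(i in [set: I]) ((c i)%:E * nu i s).
  by apply: esum_ge0 => i _; rewrite mule_ge0 ?lee_fin.
have int_ge0 : 0 <= \int[P0]_(t in s) `|(w t)%:E| by apply: integral_ge0.
move: sum_ge0; rewrite nuE//.
rewrite (eq_integral (fun t : mR => - `|(w t)%:E|)); last first.
  by move=> t /[!inE] st; exact: absw.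
rewrite integral_ge0N// oppe_ge0 => int_le0.
have -> : \int[P0]_(t in s) `|(w t)%:E| = 0.
  by apply/eqP; rewrite eq_le int_le0 int_ge0.
by rewrite oppe0.
Qed.

Lemma nu_null01 i : nu i `[0%R, 1%R]%classic = 0.
Proof.
have [S0 _] := int_w01 (BRplus01 R) (@subset_refl _ _).
have : (c i)%:E * nu i `[0%R, 1%R]%classic <= 0.
  rewrite -S0; apply: esum_ge; exists [set i]; first by split.
  by rewrite fsbig_set1.
rewrite pmule_rle0 ?lte_fin// => nu_le0.
by apply/eqP; rewrite eq_le nu_le0 measure_ge0.
Qed.

Lemma P0_null01 : P0 `[0%R, 1%R[%classic = 0.
Proof.
have s01 : `[0%R, 1%R[%classic `<=` (`[0%R, 1%R]%classic : set R).
  by move=> t /=; rewrite !in_itv/= => /andP[-> /ltW].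
have Bs := BRplus01o R; have m01 := measurable_BRplus Bs.
have [_ int0] := int_w01 Bs s01.
have mwE : measurable_fun (`[0%R, 1%R[%classic : set mR) (EFin \o w).
  exact/measurable_EFinP.
have /(ae_eq_integral_abs P0 m01 mwE)[N [mN N0 sN]] := int0.
apply/eqP; rewrite -measure_le0 -N0 le_measure ?inE//.
move=> t t01; apply: sN => /= wt0; have := wt0 t01.
move: t01; rewrite /= in_itv/= => /andP[t0 t1] [].
by apply/eqP; rewrite lt_eqF// subr_lt0 exprn_ilt1.
Qed.

(** On (1, +oo) the density is positive, and the integral of [f / w] against a
    measure with density [w] is the integral of [f]; the [nu i] do not charge
    the rest of [s], where [w] may be negative or zero. *)
Lemma esum_integral_div (f : mR -> R) s : BRplus s ->
    measurable_fun s f -> (forall t, s t -> (0 <= f t)%R) ->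
  \esum_(i in [set: I]) ((c i)%:E * \int[nu i]_(t in s) (f t / w t)%:E) =
  \int[P0]_(t in s `&` `]1%R, +oo[%classic) (f t)%:E.
Proof.
move=> Bs mf f0; have ms := measurable_BRplus Bs.
set D := s `&` _.
have D1 : D = s `\` `[0%R, 1%R]%classic.
  rewrite /D; apply/seteqP; split => t /=; rewrite !in_itv/= andbT.
    by move=> [st t1]; split => //; apply/negP; rewrite negb_and -!ltNge t1 orbT.
  by move=> [st /negP]; rewrite negb_and -!ltNge [(t < 0)%R]ltNge (BRplus_ge0 Bs st).
have Dgt1 t : D t -> (1 < t)%R by case => _ /=; rewrite in_itv/= andbT.
have mD : measurable D by apply: measurableI => //; exact: measurable_itv.
have BD : BRplus D by apply: BRplus_subset Bs mD _; exact: subIsetl.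
have mfw A : measurable_fun A f -> measurable_fun A (fun t => (f t / w t)%:E).
  by move=> mfA; apply/measurable_EFinP/measurable_funM => //; exact: measurable_invB1.
transitivity (\esum_(i in [set: I])
    ((c i)%:E * \int[nu i]_(t in D) (f t / w t)%:E)).
  apply: eq_esum => i _; congr (_ * _).
  rewrite (@integral_setD_null _ _ _ `[0%R, 1%R]%classic) -?D1//.
  - exact: mfw.
  - exact: nu_null01.
have mfD : measurable_fun D f by apply: measurable_funS mf => //; exact: subIsetl.
rewrite (@ge0_esum_integral_density _ _ _ _ c nu P0 D w)//.
- apply: eq_integral => t /[!inE] Dt; rewrite -EFinM mulfVK//.
  by rewrite gt_eqF// w_gt0// Dgt1.
- by move=> t Dt; rewrite ltW// w_gt0// Dgt1.
- by move=> A mA AD; apply: nuE; exact: BRplus_subset mA AD.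
- exact: mfw.
- move=> t Dt; rewrite lee_fin divr_ge0 ?f0//; first by case: Dt.
  by rewrite ltW// w_gt0// Dgt1.
Qed.

Lemma split_at1 s : BRplus s ->
  P0 s = P0 (s `&` `]1%R, +oo[%classic) + P0 (s `&` [set 1%R]).
Proof.
move=> Bs; have ms := measurable_BRplus Bs.
have m1 : measurable ([set 1%R] : set mR) by exact: measurable_set1.
have mgt1 : measurable (`]1%R, +oo[%classic : set mR) by exact: measurable_itv.
have mlt1 := measurable_BRplus (BRplus01o R).
have lt1_null : P0 (s `&` `[0%R, 1%R[%classic) = 0.
  by apply/eqP; rewrite -measure_le0 -P0_null01 le_measure ?inE//; exact: measurableI.
have sE : s = (s `&` `]1%R, +oo[%classic `|` s `&` [set 1%R]) `|`
    s `&` `[0%R, 1%R[%classic.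
  rewrite -!setIUr; apply/esym/setIidPl => t st /=; rewrite !in_itv/= andbT.
  by rewrite (BRplus_ge0 Bs st)/=; case: (ltgtP t 1%R) => t1;
    [right|left; left|left; right].
rewrite {1}sE measureU//; last 3 first.
- by apply: measurableU; exact: measurableI.
- exact: measurableI.
- apply/seteqP; split => // t /=; rewrite !in_itv/= andbT.
  by move=> -[[[_ t1]|[_ ->]]] [_ /andP[_]]; [rewrite ltNge ltW|rewrite ltxx].
rewrite [X in (_ + X)%R = _](_ : _ = 0); last exact: lt1_null.
rewrite adde0 measureU//; [exact: measurableI|exact: measurableI|].
apply/seteqP; split => // t /=; rewrite in_itv/= andbT => -[[_ t1] [_ t1E]].
by move: t1; rewrite t1E ltxx.
Qed.

(** By the density relation the integral of [t ^+ kappa.+1] against [P0] over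
    the half-line exceeds the total mass of the weighted [nu i] by that of
    [P0]. *)
Lemma esum_integral_expr_div_fin : P0 (@Rplus R) < +oo ->
    \esum_(i in [set: I]) ((c i)%:E * nu i (@Rplus R)) < +oo ->
  \esum_(i in [set: I]) ((c i)%:E *
    \int[nu i]_(t in @Rplus R) (t ^+ kappa.+1 / w t)%:E) < +oo.
Proof.
move=> P0fin nufin.
have BR := BRplus_Rplus R.
have mR0 := measurable_BRplus BR.
rewrite (esum_integral_div BR); last 2 first.
- exact: measurable_exprn.
- by move=> t Rt; exact: exprn_ge0_BRplus BR Rt.
apply: (@le_lt_trans _ _ (\int[P0]_(t in @Rplus R) (t ^+ kappa.+1)%:E)).
  apply: ge0_subset_integral => //.
  - by apply: measurableI => //; exact: measurable_itv.
  - by apply/measurable_EFinP; exact: measurable_exprn.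
  - by move=> t Rt; rewrite lee_fin; exact: exprn_ge0_BRplus BR Rt.
have P0num : P0 (@Rplus R) \is a fin_num by rewrite ge0_fin_numE.
move: nufin; rewrite nuE// ge0_integralB1//.
- by rewrite -(fineK P0num); case: (integral _ _ _) => [x _||]//; exact: ltry.
- by move=> t Rt; exact: exprn_ge0_BRplus BR Rt.
Qed.

End representing_measure.

(** * The graph of the self-map *)

Section graph.
Context (eta : option nat) (kappa : nat).
Notation X := (X eta kappa).
Notation phi := (@phi eta kappa).
Notation root := (@xt eta kappa ord0).
Notation top := (@xt eta kappa ord_max).

(** Branches are numbered from 0, so that the exponent of [t] in the moment
    formulas is the position in the chain. *)
Definition Jn (n : nat) : J None := exist _ n.+1 isT.

Lemma JnP (j : J None) : j = Jn (val j).-1.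
Proof. by apply: val_inj; case: j => -[]. Qed.

Definition trunk (n : nat) : X := xt eta (inord n).

Definition branch (i : J eta) (n : nat) : X := xb kappa i (Jn n).

Lemma trunkP (r : 'I_kappa.+1) : xt eta r = trunk r.
Proof. by rewrite /trunk inord_val. Qed.

Lemma trunk0 : trunk 0 = root.
Proof. by rewrite (trunkP ord0). Qed.

Lemma phi_branchS i n : phi (branch i n.+1) = branch i n.
Proof. by rewrite /branch/= (insubT (fun k => (0 < k)%N && true)). Qed.

Lemma phi_branch0 i : phi (branch i 0) = top.
Proof. by rewrite /branch/= insubF. Qed.

Lemma phi_root : phi root = top. Proof. by []. Qed.

Lemma phi_trunkS n : (n < kappa)%N -> phi (trunk n.+1) = trunk n.
Proof.
by move=> nk; rewrite /trunk/= ifF ?inordK//; apply/eqP => /(congr1 val)/=; rewrite inordK.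
Qed.

Lemma X_cases (y : X) : [\/ y = root,
  exists2 n, (n < kappa)%N & y = trunk n.+1,
  exists i, y = branch i 0 | exists i n, y = branch i n.+1].
Proof.
case: y => [r|[i j]].
  case: r => -[|n] nk; first by constructor 1; congr inl; exact: val_inj.
  constructor 2; exists n => //; exact: (trunkP (Ordinal nk)).
rewrite [j]JnP; case: (val j).-1 => [|n]; first by constructor 3; exists i.
by constructor 4; exists i, n.
Qed.

Lemma trunk_inj n m : (n <= kappa)%N -> (m <= kappa)%N -> trunk n = trunk m -> n = m.
Proof. by move=> nk mk [] /(congr1 val)/=; rewrite !inordK. Qed.

Lemma top_trunk : top = trunk kappa. Proof. exact: trunkP. Qed.

Lemma preimage_branch i n : phi @^-1` [set branch i n] = [set branch i n.+1].
Proof.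
apply/seteqP; split => y /=; last by move=> ->; rewrite phi_branchS.
case: (X_cases y) => [->|[m mk ->]|[i' ->]|[i' [m ->]]].
- by rewrite phi_root.
- by rewrite phi_trunkS.
- by rewrite phi_branch0.
- by rewrite phi_branchS => -[-> ->].
Qed.

Lemma preimage_trunk n : (n < kappa)%N ->
  phi @^-1` [set trunk n] = [set trunk n.+1].
Proof.
move=> nk; apply/seteqP; split => y /=; last by move=> ->; rewrite phi_trunkS.
have neq : top <> trunk n.
  by rewrite top_trunk => /(trunk_inj (leqnn _) (ltnW nk)) nE; move: nk; rewrite -nE ltnn.
case: (X_cases y) => [->|[m mk ->]|[i' ->]|[i' [m ->]]].
- by rewrite phi_root.
- by rewrite phi_trunkS// => /trunk_inj ->//; exact: ltnW.
- by rewrite phi_branch0.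
- by rewrite phi_branchS.
Qed.

Lemma preimage_top :
  phi @^-1` [set top] = [set root] `|` range (branch ^~ 0%N).
Proof.
apply/seteqP; split => y /=; last first.
  by move=> [->|[i _ <-]]; [exact: phi_root|exact: phi_branch0].
case: (X_cases y) => [->|[m mk ->]|[i' ->]|[i' [m ->]]].
- by left.
- by rewrite phi_trunkS// top_trunk => /(trunk_inj (ltnW mk) (leqnn _)) mE; move: mk; rewrite mE ltnn.
- by right; exists i'.
- by rewrite phi_branchS.
Qed.

Lemma range_phi (y : X) : range phi y.
Proof.
case: (X_cases y) => [->|[n nk ->]|[i ->]|[i [n ->]]].
- case: (posnP kappa) => [k0|k_gt0].
    by exists root => //; rewrite phi_root top_trunk -trunk0; congr trunk.
  by exists (trunk 1) => //; rewrite phi_trunkS// trunk0.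
- have [nk'|] := ltnP n.+1 kappa; first by exists (trunk n.+2) => //; rewrite phi_trunkS.
  move=> kn; exists root => //; rewrite phi_root top_trunk.
  by congr trunk; apply/eqP; rewrite eqn_leq kn nk.
- by exists (branch i 1) => //; rewrite phi_branchS.
- by exists (branch i n.+2) => //; rewrite phi_branchS.
Qed.

End graph.

(** * Density of the domain of the composition operator *)

Section discrete.
Context (R : realType) (eta : option nat) (kappa : nat).
Notation X := (X eta kappa).
Notation phi := (@phi eta kappa).
Variable mu : {measure set X -> \bar R}.

Lemma discrete_measure_fin x : discrete_measure mu -> mu [set x] < +oo.
Proof.
move=> [[F FT Ff] _].
have : [set: X] x by [].
rewrite FT => -[n _ Fx]; have [mF] := Ff n; apply: le_lt_trans.
by rewrite le_measure ?inE// => y ->.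
Qed.

(** Chebyshev's inequality for the square of the norm. *)
Lemma L2norm_ge (h : X -> R[i]) (A : set X) (a : R) : (0 <= a)%R ->
    (forall x, A x -> (a <= Normc.normc (h x))%R) ->
  (a ^+ 2)%:E * mu A <= L2norm mu h `^ 2.
Proof.
move=> a0 ah; rewrite /L2norm poweR_Lnorm//.
rewrite -(@integral_cst _ _ _ mu A)//.
apply: (@le_trans _ _ (\int[mu]_(x in A) (`|(Normc.normc (h x))%:E| `^ 2))).
  apply: ge0_le_integral => //.
  - by move=> x _; rewrite lee_fin exprn_ge0.
  - move=> x Ax /=; rewrite lee_fin powR_mulrn//.
    by rewrite lerXn2r ?nnegrE// (le_trans (ah _ Ax))// ler_norm.
apply: ge0_subset_integral => //.
by move=> x _; exact: poweR_ge0.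
Qed.

End discrete.

Section summability.
Context (R : realType) (eta : option nat) (kappa : nat).
Notation X := (X eta kappa).
Notation phi := (@phi eta kappa).
Notation top := (@xt eta kappa ord_max).
Variable mu : {measure set X -> \bar R}.
Hypothesis hmu : discrete_measure mu.

Let ind_top : X -> R[i] := fun x => ((x == top)%:R)%R.

Lemma normc_ind_top x : Normc.normc (ind_top x) = \1_[set top] x.
Proof.
rewrite /ind_top indicE; case: eqP => [->|xt].
  by rewrite Normc.normc1 mem_set.
by rewrite Normc.normc0 memNset.
Qed.

Lemma L2_ind_top : L2 mu ind_top.
Proof.
split => //; rewrite /L2norm unlock; apply: poweR_lty.
rewrite (eq_integral (EFin \o \1_[set top])); last first.
  move=> x _ /=; rewrite normc_ind_top powR_mulrn// indicE.
  by case: (x \in _); rewrite /= ?normr1 ?normr0 ?expr1n ?expr0n.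
by rewrite integral_indic// setIT discrete_measure_fin.
Qed.

(** A function [g] of the domain that is close enough to the indicator of the
    top point does not vanish there.  Its composition with [phi] is constant
    and nonzero on the preimage of the top point, and square integrable. *)
Lemma densely_defined_preimage_top_fin :
  comp_op_densely_defined mu phi -> mu (phi @^-1` [set top]) < +oo.
Proof.
move=> dd.
have top_fin : mu [set top] \is a fin_num.
  by rewrite ge0_fin_numE ?discrete_measure_fin.
have top_gt0 : (0 < fine (mu [set top]))%R.
  by rewrite fine_gt0// hmu.2 discrete_measure_fin.
(* A function that vanishes at the top point is at distance at least this from
   the indicator. *)
have e0 : (0 < Num.sqrt (fine (mu [set top])))%R by rewrite sqrtr_gt0.
have [g [Lg [_ _ Lgphi]] fg] := dd _ L2_ind_top _ e0.
have g_top : (0 < Normc.normc (g top))%R.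
  rewrite lt_neqAle; apply/andP; split; last by case: (g top) => a b; rewrite /= sqrtr_ge0.
  apply/negP => /eqP/esym/Normc.eq0_normc g0.
  have : mu [set top] <= L2norm mu (ind_top \- g)%R `^ 2.
    have := @L2norm_ge _ _ _ mu (ind_top \- g)%R [set top] 1 ler01.
    rewrite expr1n mul1e; apply => x -> /=.
    by rewrite g0 subr0 normc_ind_top indicE mem_set.
  apply/negP; rewrite -ltNge -(fineK top_fin).
  rewrite -(sqr_sqrtr (ltW top_gt0)) -powR_mulrn ?sqrtr_ge0// -poweR_EFin.
  have L2ge0 h : 0 <= L2norm mu h by exact: Lnorm_ge0.
  have := L2ge0 (ind_top \- g)%R; move: fg; case: (L2norm _ _) => [l||]//.
  rewrite lte_fin lee_fin => lt_l l0; rewrite !poweR_EFin lte_fin.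
  by rewrite gt0_ltr_powR ?nnegrE ?sqrtr_ge0.
have := @L2norm_ge _ _ _ mu (g \o phi)%FUN (phi @^-1` [set top]) _
  (ltW g_top).
have Nfin : L2norm mu (g \o phi)%FUN `^ 2 < +oo by exact: poweR_lty.
move=> /(_ _)/le_lt_trans/(_ Nfin) H; have {H} :
   (Normc.normc (g top) ^+ 2)%:E * mu (phi @^-1` [set top]) < +oo.
  by apply: H => x /= ->.
by rewrite -lte_pdivlMl ?exprn_gt0// mulry gtr0_sg ?mul1e// invr_gt0 exprn_gt0.
Qed.

Lemma esum_branch0_le :
  \esum_(i in [set: J eta]) mu [set branch kappa i 0%N] <=
  mu (phi @^-1` [set top]).
Proof.
apply: ge_ereal_sup => _ [/= F [finF _] <-].
rewrite -measure_fin_bigcup//; last first.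
  move=> i j _ _ [x /= [-> []]]; exact: id.
apply: le_measure; rewrite ?inE//.
by move=> _ [i _ ->]; exact: phi_branch0.
Qed.

End summability.

(** * The consistency condition as a system of moment equations *)

Section consistency.
Context (R : realType) (eta : option nat) (kappa : nat).
Notation X := (X eta kappa).
Notation phi := (@phi eta kappa).
Notation root := (@xt eta kappa ord0).
Notation top := (@xt eta kappa ord_max).
Notation mR := (measurableTypeR R).
Notation trunk := (@trunk eta kappa).
Notation branch := (@branch eta kappa).
Variable mu : {measure set X -> \bar R}.
Hypothesis hmu : discrete_measure mu.
Variable P : X -> probability mR R.

Definition mass (x : X) : R := fine (mu [set x]).

Lemma mass_gt0 x : (0 < mass x)%R.
Proof. by rewrite /mass fine_gt0// hmu.2 discrete_measure_fin. Qed.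

Let mass_neq0 x : mass x != 0%R. Proof. by rewrite gt_eqF ?mass_gt0. Qed.

Lemma massE x : mu [set x] = (mass x)%:E.
Proof. by rewrite /mass fineK// ge0_fin_numE// discrete_measure_fin. Qed.

Lemma mass_ratioE x y : mu [set x] / mu [set y] = (mass x / mass y)%:E.
Proof. by rewrite !massE inver (negbTE (mass_neq0 y)) -EFinM. Qed.

(** As [phi] is surjective, each of its fibres contributes one equation. *)
Lemma CC_split : CC mu P <->
  [/\ forall n s, (n < kappa)%N -> BRplus s ->
        (mass (trunk n))^-1%:E * ((mass (trunk n.+1))%:E * P (trunk n.+1) s) =
        \int[P (trunk n)]_(t in s) t%:E,
      forall i n s, BRplus s ->
        (mass (branch i n))^-1%:E * ((mass (branch i n.+1))%:E * P (branch i n.+1) s) =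
        \int[P (branch i n)]_(t in s) t%:E
    & forall s, BRplus s ->
        (mass top)^-1%:E * ((mass root)%:E * P root s +
           \esum_(i in [set: J eta]) ((mass (branch i 0))%:E * P (branch i 0) s)) =
        \int[P top]_(t in s) t%:E].
Proof.
have invE x : (mu [set x])^-1 = (mass x)^-1%:E.
  by rewrite massE inver (negbTE (mass_neq0 x)).
have mP0 x s : 0 <= mu [set x] * P x s by rewrite mule_ge0.
have trunkE n s : (n < kappa)%N ->
    \esum_(y in phi @^-1` [set trunk n]) (mu [set y] * P y s) =
    (mass (trunk n.+1))%:E * P (trunk n.+1) s.
  by move=> nk; rewrite preimage_trunk// esum_set1// massE.
have branchE i n s :
    \esum_(y in phi @^-1` [set branch i n]) (mu [set y] * P y s) =
    (mass (branch i n.+1))%:E * P (branch i n.+1) s.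
  by rewrite preimage_branch// esum_set1// massE.
have topE s : \esum_(y in phi @^-1` [set top]) (mu [set y] * P y s) =
    (mass root)%:E * P root s +
    \esum_(i in [set: J eta]) ((mass (branch i 0))%:E * P (branch i 0) s).
  rewrite preimage_top (esumID [set root])//; congr (_ + _).
    by rewrite setUK esum_set1// massE.
  rewrite (_ : _ `&` _ = range (branch ^~ 0%N)).
    rewrite esum_image; first by apply: eq_esum => i _; rewrite massE.
    by move=> i j _ _ [].
  apply/seteqP; split => y /=; first by case=> -[].
  by case=> i _ <-; split; [right; exists i|].
split=> [cc|[ccT ccB cctop] s x Bs _].
- split=> [n s nk Bs|i n s Bs|s Bs]; rewrite -?trunkE// -?branchE -?topE -invE cc//;
    exact: range_phi.
- rewrite invE; case: x => [r|[i j]].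
    rewrite -/(xt eta r).
    have [rk|kr] := ltnP r kappa; first by rewrite trunkP trunkE// ccT.
    have -> : r = ord_max by apply/val_inj/eqP; rewrite eqn_leq kr -ltnS ltn_ord.
    by rewrite topE cctop.
  by rewrite [j]JnP -/(xb _ _ _) -/(branch _ _) branchE ccB.
Qed.

(** The equations along the trunk and along each branch are instances of
    [moment_chain].  Given the former, the equation at the top point reads
    [m_0 P_0 + m_0 S = m_0 M], where [S] is the weighted sum of the measures
    at the [x_{i,1}] and [M] the integral of [t ^+ kappa.+1] against [P_0]; as
    [P_0] is finite this means [S = M - P_0]. *)
Lemma CC_moments : CC mu P <->
  [/\ forall n s, (n <= kappa)%N -> BRplus s ->
        P (trunk n) s =
        (mass root / mass (trunk n))%:E * \int[P root]_(t in s) (t ^+ n)%:E,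
      forall s, BRplus s ->
        \esum_(i in [set: J eta])
          ((mass (branch i 0) / mass root)%:E * P (branch i 0) s) =
        \int[P root]_(t in s) (t ^+ kappa.+1 - 1)%:E
    & forall i n s, BRplus s ->
        P (branch i n) s = (mass (branch i 0) / mass (branch i n))%:E *
          \int[P (branch i 0)]_(t in s) (t ^+ n)%:E].
Proof.
have chainT := @moment_chain R (fun n => P (trunk n)) (mass \o trunk) kappa
  (fun n => mass_gt0 (trunk n)).
have chainB i N := @moment_chain R (fun n => P (branch i n))
  (mass \o branch i) N (fun n => mass_gt0 (branch i n)).
rewrite /= trunk0 in chainT.
have top_step : (forall s, BRplus s -> P top s =
       (mass root / mass top)%:E * \int[P root]_(t in s) (t ^+ kappa)%:E) ->
    forall s, BRplus s ->
    ((mass top)^-1%:E * ((mass root)%:E * P root s +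
        \esum_(i in [set: J eta]) ((mass (branch i 0))%:E * P (branch i 0) s)) =
        \int[P top]_(t in s) t%:E) <->
    (\esum_(i in [set: J eta])
          ((mass (branch i 0) / mass root)%:E * P (branch i 0) s) =
        \int[P root]_(t in s) (t ^+ kappa.+1 - 1)%:E).
  move=> PtopE s Bs; have ms := measurable_BRplus Bs.
  rewrite (integral_expr_density _ Bs PtopE); last first.
    by rewrite divr_ge0 ?ltW ?mass_gt0.
  have Pfin : P root s \is a fin_num by exact: fin_num_measure.
  rewrite ge0_integralB1//; first last.
  - by move=> t st; exact: exprn_ge0_BRplus Bs st.
  - by rewrite ltey_eq Pfin.
  have -> : \esum_(i in [set: J eta]) ((mass (branch i 0))%:E * P (branch i 0) s) =
      (mass root)%:E * \esum_(i in [set: J eta])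
          ((mass (branch i 0) / mass root)%:E * P (branch i 0) s).
    rewrite -ge0_esumZl ?ltW ?mass_gt0//; last first.
      by move=> i; rewrite mule_ge0// lee_fin divr_ge0 ?ltW ?mass_gt0.
    apply: eq_esum => i _; rewrite muleA -EFinM; congr (_%:E * _).
    by field; rewrite mass_neq0.
  rewrite -muleDr//; last by rewrite fin_num_adde_defr.
  rewrite muleA -EFinM [(_^-1 * _)%R]mulrC.
  have r0 : (0 < mass root / mass top)%R by rewrite divr_gt0 ?mass_gt0.
  set S := \esum_(i in _) _; set I := integral _ _ _.
  split => [/(congr1 (fun x => (mass root / mass top)^-1%:E * x))|->].
    rewrite !muleA -!EFinM mulVf ?gt_eqF// !mul1e => <-.
    by rewrite addeAC subee// add0e.
  by rewrite [P root s + _]addeC subeK.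
split=> [/CC_split[ccT ccB cctop]|[momT momtop momB]].
- have momT := chainT.1 ccT.
  split => // [s Bs|i n s Bs]; last by apply: (chainB i n).1 => // k A _; exact: ccB.
  apply/top_step => //; last exact: cctop.
  by move=> A BA; rewrite top_trunk momT.
- apply/CC_split; split; first exact: chainT.2.
    move=> i n s Bs; apply: (chainB i n.+1).2 => // k A _; exact: momB.
  move=> s Bs; apply/top_step => //; last exact: momtop.
  by move=> A BA; rewrite top_trunk momT.
Qed.

End consistency.

(** * The theorem *)

Theorem theorem4p1p1 (R : realType) (eta : option nat) (heta : eta <> Some 0%N)
    (kappa : nat) (mu : {measure set (X eta kappa) -> \bar R})
    (hmu : discrete_measure mu)
    (hdense : comp_op_densely_defined mu (@phi eta kappa))
    (P : X eta kappa -> probability (measurableTypeR R) R)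
    (hP : forall x, on_Rplus (P x)) :
  (CC mu P <->
     [/\ (* (i) *)
         forall (r : 'I_kappa.+1) s, BRplus s ->
           P (xt eta r) s =
           mu [set xt eta ord0] / mu [set xt eta r] *
           \int[P (xt eta ord0)]_(t in s) (t ^+ r)%:E,
         (* (ii) *)
         forall s, BRplus s ->
           \esum_(i in [set: J eta])
             (mu [set xb kappa i J1] / mu [set xt eta ord0] *
              P (xb kappa i J1) s) =
           \int[P (xt eta ord0)]_(t in s) (t ^+ kappa.+1 - 1)%:E
       & (* (iii) *)
         forall (i : J eta) (j : J None) s, (2 <= val j)%N -> BRplus s ->
           P (xb kappa i j) s =
           mu [set xb kappa i J1] / mu [set xb kappa i j] *
           \int[P (xb kappa i J1)]_(t in s) (t ^+ (val j).-1)%:E]) /\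
  (CC mu P ->
     (* (iv) *)
     ((forall r : 'I_kappa.+1, P (xt eta r) `[(0 : R)%R, (1 : R)%R[%classic = 0) /\
      (forall (i : J eta) (j : J None), P (xb kappa i j) `[(0 : R)%R, (1 : R)%R]%classic = 0)) /\
     (* (v) *)
     (forall s, BRplus s ->
        P (xt eta ord0) (s `&` `](1 : R)%R, +oo[%classic) = sum_inv mu P s) /\
     (* (vi) *)
     sum_inv mu P (@Rplus R) <= 1 /\
     (* (vii) *)
     P (xt eta ord0) [set 1%R] = vartheta mu P /\
     (* (viii) *)
     (forall s, BRplus s ->
        P (xt eta ord0) s =
        sum_inv mu P s + vartheta mu P * \d_(1%R : measurableTypeR R) s) /\
     (* (ix) *)
     \esum_(i in [set: J eta])
       (mu [set xb kappa i J1] / mu [set xt eta ord0] *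
        \int[P (xb kappa i J1)]_(t in @Rplus R)
          (t ^+ kappa.+1 / (t ^+ kappa.+1 - 1))%:E) < +oo).
Proof.
have ratio := mass_ratioE hmu.
set c := fun i : J eta => (mass mu (branch kappa i 0) / mass mu (xt eta ord0))%R.
have c_gt0 i : (0 < c i)%R by rewrite divr_gt0// mass_gt0.
have CC_cond := CC_moments hmu P.
split.
  split=> [/CC_cond[momT momtop momB]|[condT condtop condB]].
  - split=> [r s Bs|s Bs|i j s j2 Bs].
    + by rewrite ratio trunkP momT ?inordK// -ltnS.
    + by rewrite -momtop//; apply: eq_esum => i _; rewrite ratio.
    + by rewrite [j]JnP ratio momB.
  - apply/CC_cond; split=> [n s nk Bs|s Bs|i n s Bs].
    + by rewrite condT// ratio inordK.
    + by rewrite -condtop//; apply: eq_esum => i _; rewrite ratio.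
    (* Position 0 is x_{i,1}, where (iii) says nothing and the moment formula is
       an identity. *)
    + case: n => [|n]; last by rewrite condB// ratio.
      rewrite integral_expr0; last exact: measurable_BRplus.
      by rewrite divff ?mul1e// gt_eqF// mass_gt0.
move=> /CC_cond[momT momtop momB].
set Q := fun i : J eta => P (branch kappa i 0).
have nuE s : BRplus s -> \esum_(i in [set: J eta]) ((c i)%:E * Q i s) =
    \int[P (xt eta ord0)]_(t in s) (t ^+ kappa.+1 - 1)%:E by exact: momtop.
have BR := BRplus_Rplus R.
have P0_split s : BRplus s -> P (xt eta ord0) s =
    P (xt eta ord0) (s `&` `](1 : R)%R, +oo[%classic) +
    P (xt eta ord0) (s `&` [set 1%R]).
  by move=> Bs; exact: split_at1 c_gt0 nuE _ Bs.
have sum_invE s : BRplus s ->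
    sum_inv mu P s = P (xt eta ord0) (s `&` `](1 : R)%R, +oo[%classic).
  move=> Bs; have ms := measurable_BRplus Bs.
  rewrite -integral_expr0; last by apply: measurableI => //; exact: measurable_itv.
  rewrite -(esum_integral_div c_gt0 nuE Bs).
  - apply: eq_esum => i _; rewrite ratio; congr (_ * _).
    by apply: eq_integral => t _; rewrite expr0 div1r.
  - exact: measurable_exprn.
  - by move=> t st; exact: exprn_ge0_BRplus Bs st.
have P0_1 : P (xt eta ord0) [set 1%R] = vartheta mu P.
  have := P0_split _ BR; rewrite hP -sum_invE// [_ `&` [set 1%R]]setIidr; last first.
    by move=> t ->; rewrite /Rplus/= in_itv/= andbT ler01.
  rewrite /vartheta => ->; rewrite addeAC subee ?add0e//.
  by rewrite sum_invE// fin_num_measure//; apply: measurableI => //; exact: measurable_itv.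
split; [split|split; [|split; [|split; [|split]]]].
- move=> r; rewrite trunkP (momT _ _ _ (BRplus01o R)) -1?ltnS//.
  rewrite null_set_integral ?mule0//; last exact: P0_null01 c_gt0 nuE.
  by apply/measurable_EFinP; exact: measurable_exprn.
- move=> i j; rewrite [j]JnP (momB _ _ _ (BRplus01 R)).
  rewrite null_set_integral ?mule0//; last exact: nu_null01 c_gt0 nuE i.
  by apply/measurable_EFinP; exact: measurable_exprn.
- by move=> s Bs; rewrite sum_invE.
- rewrite sum_invE// probability_le1//.
  by apply: measurableI => //; exact: measurable_itv.
- exact: P0_1.
- move=> s Bs; rewrite sum_invE// [LHS]P0_split//; congr (_ + _).
  rewrite -P0_1 diracE; have [s1|s1] := pselect (s 1%R).
    by rewrite mem_set// mule1 setIidr// => t ->.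
  rewrite memNset// mule0 (_ : _ `&` _ = set0) ?measure0//.
  by apply/seteqP; split => // t /= [st t1]; move: st; rewrite t1.
(* The points x_{i,1} lie in the preimage of the top point, of finite measure. *)
- have sum_c : \esum_(i in [set: J eta]) ((c i)%:E * Q i (@Rplus R)) < +oo.
    rewrite (eq_esum (b := fun i : J eta =>
        (mass mu (xt eta ord0))^-1%:E * mu [set branch kappa i 0])); last first.
      by move=> i _; rewrite hP mule1 massE// -EFinM mulrC.
    rewrite ge0_esumZl//; last by rewrite invr_ge0 ltW// mass_gt0.
    apply: lte_mul_pinfty; rewrite ?lee_fin ?invr_ge0 ?(ltW (mass_gt0 _ _))//.
    apply: le_lt_trans (esum_branch0_le mu) _.
    exact: densely_defined_preimage_top_fin.
  have P0R : P (xt eta ord0) (@Rplus R) < +oo by rewrite hP ltry.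
  have := esum_integral_expr_div_fin c_gt0 nuE P0R sum_c.
  by congr (_ < _); apply: eq_esum => i _; rewrite ratio.
Qed.
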